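(* Let $F:\Sigma^s\times M\to\Sigma^s\times M$ be a step skew product over the Bernoulli shift whose fiber maps are diffeomorphisms of a compact manifold $M$ (possibly with boundary) onto itself. Then the statistical attractor $A_{stat}(F)$ is Lyapunov stable if and only if its projection to the fiber $\pi_M(A_{stat}(F))$ is Lyapunov stable, in the sense that the set $\Sigma^s\times\pi_M(A_{stat}(F))$ is Lyapunov stable for $F$. The same statement holds with the Milnor attractor $A_M(F)$ in place of $A_{stat}(F)$.
   Context: $\Sigma^s=\{1,\dots,s\}^{\mathbb Z}$ with distance $d(\omega,\tilde\omega)=2^{-m}$, $m=\min\{|n|:\omega_n\neq\tilde\omega_n\}$, and the $(1/s,\dots,1/s)$-Bernoulli probability measure $\mu_{\Sigma^s}$; $(\sigma\omega)_n=\omega_{n+1}$ is the Bernoulli shift. $M$ is a compact Riemannian manifold, possibly with boundary. A step skew product with fiber $M$ and fiber maps $f_1,\dots,f_s:M\to M$ is the map $F:X\to X$, $X=\Sigma^s\times M$, $F(\omega,p)=(\sigma\omega,f_{\omega_0}(p))$. The metric on $X$ is the sum of the distances in the base and the fiber; $\mu_X$ is the product of $\mu_{\Sigma^s}$ and the Lebesgue (Riemannian volume) measure on $M$. $\pi_M:X\to M$ is the projection to the fiber. The Milnor attractor $A_M(F)$ is the smallest closed subset of $X$ containing $\omega(x)$ for $\mu_X$-a.e. $x$. For $x\in X$ and $U\subset X$, let $Freq(x,U)=\limsup_{N\to\infty}\frac1N\#\{0\le n<N:F^n(x)\in U\}$; the statistical $\omega$-limit set $\omega_{stat}(x)$ is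 the set of $z\in X$ such that $Freq(x,U)>0$ for every neighborhood $U$ of $z$. The statistical attractor $A_{stat}(F)$ is the smallest closed subset of $X$ containing $\omega_{stat}(x)$ for $\mu_X$-a.e. $x$. An invariant or absorbing ($F(A)\subset A$) closed set $A\subset X$ is Lyapunov stable if for any neighborhood $U$ of $A$ there is a smaller neighborhood $V$ of $A$ such that positive semi-trajectories starting in $V$ never leave $U$. *)

(* Defs.v *)
From HB Require Import structures.
From mathcomp Require Import all_boot all_order all_algebra.
From mathcomp Require Import all_classical all_reals all_analysis.

Set Implicit Arguments.
Unset Strict Implicit.
Unset Printing Implicit Defensive.

Import Order.TTheory GRing.Theory Num.Theory.
Import numFieldNormedType.Exports.

Local Open Scope classical_set_scope.
Local Open Scope ring_scope.

(* ** The full shift *)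

(* Two-sided sequences over an alphabet of s.+1 >= 1 symbols; R is the type
   in which the distance takes its values. *)
Definition shift_space (R : realType) (s : nat) : Type := int -> 'I_s.+1.

Section shift_space.
Context {R : realType} {s : nat}.
Local Notation Sigma := (shift_space R s).
Implicit Types w : Sigma.

(* w_n <> w'_n for some n with |n| = m *)
Definition differ w w' (m : nat) : bool :=
  (w m%:Z != w' m%:Z) || (w (- m%:Z) != w' (- m%:Z)).

Definition shift_dist w w' : R :=
  if pselect (exists m, differ w w' m) is left h then 2^-1 ^+ ex_minn h else 0.

Lemma shift_dist_small w w' m : shift_dist w w' < 2^-1 ^+ m <->
  forall k, (k <= m)%N -> ~~ differ w w' k.
Proof.
rewrite /shift_dist; case: pselect => [h|h].
  case: ex_minnP => p dp pmin; rewrite ltr_iXn2l ?invr_gt0 ?invf_lt1 ?ltr1n//.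
  split=> [mp k km|H].
    by apply/negP => /pmin; rewrite leqNgt (leq_ltn_trans km mp).
  by rewrite ltnNge; apply/negP => /H; rewrite dp.
split=> [_ k _|_]; last by rewrite exprn_gt0 ?invr_gt0.
by apply/negP => dk; apply: h; exists k.
Qed.

Lemma shift_distxx w : shift_dist w w = 0.
Proof.
rewrite /shift_dist; case: pselect => // h.
by exfalso; case: h => m; rewrite /differ !eqxx.
Qed.

Lemma shift_dist_sym w w' : shift_dist w w' = shift_dist w' w.
Proof.
rewrite /shift_dist; have -> // : differ w w' = differ w' w.
by apply/funext => m; rewrite /differ eq_sym (eq_sym (w (- _))).
Qed.

Lemma shift_dist_positivity w w' : shift_dist w w' = 0 -> w = w'.
Proof.
rewrite /shift_dist; case: pselect => [h /eqP|h _].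
  by rewrite expf_eq0 invr_eq0 pnatr_eq0 andbF.
apply/funext => n; apply: contrapT => /eqP dn; apply: h; exists `|n|%N.
by rewrite /differ; case: (intP n) dn => [|k|k] ->//; rewrite orbT.
Qed.

Lemma shift_dist_ge0 w w' : 0 <= shift_dist w w'.
Proof.
by rewrite /shift_dist; case: pselect => // h; rewrite exprn_ge0 ?invr_ge0.
Qed.

Lemma shift_dist_triangle w' w w'' :
  shift_dist w w'' <= shift_dist w w' + shift_dist w' w''.
Proof.
suff: shift_dist w w'' <= Num.max (shift_dist w w') (shift_dist w' w'').
  move/le_trans; apply; rewrite ge_max lerDl lerDr.
  by rewrite !shift_dist_ge0.
rewrite leNgt; apply/negP; rewrite gt_max => /andP[].
rewrite {2 4}/shift_dist; case: pselect => [h|h]; last first.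
  by rewrite ltNge shift_dist_ge0.
case: ex_minnP => m dm _ /shift_dist_small/(_ m (leqnn m)) d1.
move=> /shift_dist_small/(_ m (leqnn m)) d2.
move: dm d1 d2; rewrite /differ !negb_or !negbK.
by move=> /orP[] /eqP dm /andP[/eqP e1 /eqP e2] /andP[/eqP e3 /eqP e4];
  apply: dm; congruence.
Qed.

HB.instance Definition _ := gen_eqMixin Sigma.
HB.instance Definition _ := gen_choiceMixin Sigma.
HB.instance Definition _ := isPointed.Build Sigma (fun=> ord0).
HB.instance Definition _ := @isMetric.Build R Sigma shift_dist
  shift_distxx shift_dist_positivity shift_dist_sym shift_dist_triangle.

Definition shift w : Sigma := fun k => w (k + 1).

End shift_space.

(* ** Borel measures *)

Definition borel (T : ptopologicalType) := g_sigma_algebraType (@open T).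

(* This determines mu: the cylinders form a pi-system generating the Borel
   sigma-algebra of the shift space. *)
Definition is_uniform_bernoulli (R : realType) (s : nat)
    (mu : probability (borel (shift_space R s)) R) :=
  forall (K : seq int) (a : int -> 'I_s.+1), uniq K ->
    mu [set w | forall k, k \in K -> w k = a k] = ((s.+1%:R^-1) ^+ size K)%:E.

(* Lebesgue measure on R^n, as an iterated product. *)
Fixpoint lebesgue_tuple (R : realType) (n : nat) :
    set (n.-tuple (measurableTypeR R)) -> \bar R :=
  if n is m.+1 then
    pushforward (lebesgue_measure \x lebesgue_tuple (n := m))%E
      (fun p : measurableTypeR R * m.-tuple (measurableTypeR R) =>
         [tuple of p.1 :: p.2])
  else dirac [tuple].
Arguments lebesgue_tuple {R} n A.

(* ** Differentiability on subsets of R^n *)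

Section regularity.
Context {R : realType} {n : nat}.
Implicit Types (O W : set 'rV[R]_n) (h : 'rV[R]_n -> R).

Fixpoint Ck (k : nat) O h : Prop :=
  if k is j.+1 then
    (forall x, O x -> differentiable h x) /\
    (forall i : 'I_n, Ck j O ('D_(delta_mx 0 i) h))
  else forall x, O x -> {for x, continuous h}.

Definition C1 O h := Ck 1 O h.
Definition Cinfty O h := forall k, Ck k O h.

(* Regularity on a set that need not be open, such as a relatively open subset
   of the half-space: existence of local extensions of the given class. *)
Definition class_on (C : set 'rV[R]_n -> ('rV[R]_n -> R) -> Prop) W h :=
  forall x, W x -> exists O h',
    [/\ open O, O x, C O h' & forall y, O y -> W y -> h' y = h y].

Definition map_class_on (C : set 'rV[R]_n -> ('rV[R]_n -> R) -> Prop) m W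
    (h : 'rV[R]_n -> 'rV[R]_m) :=
  forall j, class_on C W (fun x => h x 0 j).

(* {x_0 >= 0}; the whole (one-point) space when n = 0. *)
Definition halfspace : set 'rV[R]_n :=
  [set x | forall i : 'I_n, val i = 0%N -> 0 <= x 0 i].

End regularity.

(* ** Manifolds with (possibly empty) boundary *)

(* coord is meaningful on chart_dom only, and param, its inverse, on
   chart_image only. *)
Record chart (R : realType) (n : nat) (M : Type) := Chart {
  chart_dom : set M;
  coord : M -> 'rV[R]_n;
  param : 'rV[R]_n -> M }.

Definition chart_image R n M (c : chart R n M) := coord c @` chart_dom c.

(* A chart near an interior point of M is one whose image does not meet
   {x_0 = 0}. *)
Definition is_chart R n (M : topologicalType) (c : chart R n M) :=
  [/\ open (chart_dom c),
      exists2 O, open O & chart_image c = O `&` halfspace,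
      forall p, chart_dom c p -> param c (coord c p) = p,
      {within chart_dom c, continuous (coord c)} &
      {within chart_image c, continuous (param c)}].

Definition overlap R n M (c c' : chart R n M) :=
  coord c @` (chart_dom c `&` chart_dom c').

Definition transition R n M (c c' : chart R n M) := coord c' \o param c.

Record smooth_manifold (R : realType) (n : nat) (M : topologicalType) := {
  manifold_hausdorff : hausdorff_space M;
  manifold_second_countable : @second_countable M;
  atlas : set (chart R n M);
  atlas_chart : forall c, atlas c -> is_chart c;
  atlas_cover : forall p, exists2 c, atlas c & chart_dom c p;
  atlas_smooth : forall c c', atlas c -> atlas c' ->
    map_class_on Cinfty (overlap c c') (transition c c') }.

(* In each chart of the atlas, the Gram matrix of the metric.  With row
   vectors, the differential of a map h at x is v |-> v *m 'J h x.  The change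
   of chart formula is required at interior points only, where 'J is
   meaningful; it extends to boundary points by continuity. *)
Record riemannian_metric (R : realType) (n : nat) (M : topologicalType)
    (S : smooth_manifold R n M) := {
  gram : chart R n M -> 'rV[R]_n -> 'M[R]_n;
  gram_smooth : forall c, atlas S c -> forall i j,
    class_on Cinfty (chart_image c) (fun x => gram c x i j);
  gram_sym : forall c x, atlas S c -> chart_image c x ->
    (gram c x)^T = gram c x;
  gram_pos : forall c x (v : 'rV[R]_n), atlas S c -> chart_image c x ->
    v != 0 -> 0 < (v *m gram c x *m v^T) 0 0;
  gram_transition : forall c c' x, atlas S c -> atlas S c' ->
    interior (overlap c c') x ->
    gram c x = 'J (transition c c') x *m gram c' (transition c c' x)
               *m ('J (transition c c') x)^T }.

(* vol A = int_(coord A) sqrt(det g) dx for Borel A inside a chart; this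
   determines vol. *)
Definition is_riemannian_volume (R : realType) (n : nat) (M : ptopologicalType)
    (S : smooth_manifold R n M) (g : riemannian_metric S)
    (vol : {measure set (borel M) -> \bar R}) :=
  forall c (A : set (borel M)), atlas S c -> measurable A ->
    A `<=` chart_dom c ->
    vol A = (\int[lebesgue_tuple n]_(t in
               [set t : n.-tuple R | (coord c @` A) (\row_i tnth t i)])
               (Num.sqrt (\det (gram g c (\row_i tnth t i))))%:E)%E.

Definition C1_map (R : realType) (n : nat) (M : topologicalType)
    (S : smooth_manifold R n M) (f : M -> M) :=
  continuous f /\
  forall c c', atlas S c -> atlas S c' ->
    map_class_on C1 (coord c @` (chart_dom c `&` f @^-1` chart_dom c'))
      (coord c' \o f \o param c).

Definition diffeomorphism (R : realType) (n : nat) (M : topologicalType)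
    (S : smooth_manifold R n M) (f : M -> M) :=
  exists f' : M -> M,
    [/\ cancel f f', cancel f' f, C1_map S f & C1_map S f'].

(* ** Dynamics *)

(* The phase space carries the product topology, which is the one induced by
   the sum of the shift distance and the Riemannian distance; everything below
   depends on the metric through this topology only. *)

Definition skew_product (R : realType) (s : nat) (M : Type)
    (f : 'I_s.+1 -> M -> M) (x : shift_space R s * M) : shift_space R s * M :=
  (shift x.1, f (x.1 0) x.2).

Section dynamics.
Context {X : topologicalType} (F : X -> X).

(* The clauses "closed" and "F(A) included in A" are the standing assumptions
   under which Lyapunov stability is defined. *)
Definition lyapunov_stable (A : set X) :=
  [/\ closed A, F @` A `<=` A &
      forall U, set_nbhs A U -> exists V, [/\ set_nbhs A V, V `<=` U &
        forall x, V x -> forall k, U (iter k F x)]].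

Definition omega_limit (x : X) : set X :=
  cluster ((fun k => iter k F x) @ \oo).

Definition Freq (R : realType) (x : X) (U : set X) : \bar R :=
  limn_esup (fun N => ((\sum_(k < N) (iter k F x \in U))%N%:R / N%:R : R)%:E).

Definition omega_stat (R : realType) (x : X) : set X :=
  [set z | forall U, nbhs z U -> (0 < Freq R x U)%E].

End dynamics.

Section attractors.
Context {R : realType} {S M : ptopologicalType}.
Variables (mu : set (borel S * borel M) -> \bar R) (F : S * M -> S * M).

(* The smallest closed set containing L x for mu-almost every x, defined as
   the intersection of all such sets. *)
Definition ae_hull (L : S * M -> set (S * M)) : set (S * M) :=
  \bigcap_(A in [set A : set (S * M) |
                  closed A /\ {ae mu, forall x, L x `<=` A}]) A.

Definition milnor_attractor := ae_hull (omega_limit F).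
Definition statistical_attractor := ae_hull (omega_stat F R).

End attractors.

(* Main.v *)
Require Import Defs.
From mathcomp Require Import all_boot all_order all_algebra.
From mathcomp Require Import all_classical all_reals all_analysis.
From mathcomp Require Import measurable_realfun.
From mathcomp Require Import zify ring lra.

(** Both attractors are smallest closed sets containing a limit set of almost
    every point, and both limit sets have the form: the points none of whose
    neighborhoods is rarely visited, where rarely means finitely often (for
    the omega-limit set) or with frequency zero (for its statistical version).
    The equivalence then follows from two facts.

    The attractor A is saturated with respect to the past
    (ae_hull_past_saturated): if (w, p) belongs to A and w' has the same
    symbols as w at all negative positions, then (w', p) belongs to A.  Indeed,
    whether an orbit at time n enters a set defined by the past and the fiber
    coordinate depends on symbols that are independent of the symbol read
    next.  If almost every orbit rarely enters the part of such a set on which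
    that next symbol is c, then it rarely enters the set itself.  Fixing the
    symbols at positions 0, 1, ..., one at a time, a box that prescribes both
    past and future and is almost surely rarely visited may be freed of its
    whole constraint on the future.  The independence is exploited through a
    gambler who bets at every entrance into the set that the next symbol is
    not c, in a game slightly biased against the gambler: the wealth has
    bounded mean (integral_wealth), while it would grow too fast if the set
    were entered often and the bet rarely lost.

    Second, for a closed, absorbing, past-saturated set A, Lyapunov stability
    of A and of B, the product of the base by the projection of A, are
    equivalent (lyapunov_stable_projection).  The future of the fiber coordinate depends
    only on the symbols at nonnegative positions; hence a point whose fiber
    coordinate is close to that of a point of A can have its past replaced,
    its future kept, so as to lie near A, and stability passes from A to B.
    Conversely a point of F^J(B) has the same fiber coordinate and the same
    symbols at all positions from -J on as some point of A, so that F^J(B)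
    lies in any given neighborhood of A when J is large, and stability passes
    from B to A. *)

Set Implicit Arguments.
Unset Strict Implicit.
Unset Printing Implicit Defensive.

Import Order.TTheory GRing.Theory Num.Theory.
Import numFieldNormedType.Exports.

Local Open Scope classical_set_scope.
Local Open Scope ring_scope.

(** * The topology of the shift space *)

Section shift_topology.
Context {R : realType} {s : nat}.
Local Notation Sigma := (shift_space R s).
Implicit Types (w : Sigma) (U : set Sigma) (m : nat).

Definition agree (lo hi : int) w w' := forall k, lo <= k < hi -> w k = w' k.

Definition agree_past w w' := forall k : int, k < 0 -> w k = w' k.

Definition window m w : set Sigma := [set w' | agree (- m%:Z) m%:Z w w'].

Definition splice w w' : Sigma := fun k => if k < 0 then w k else w' k.

Lemma window_dist w w' m : window m.+1 w w' -> shift_dist w w' < 2^-1 ^+ m :> R.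
Proof.
move=> ww'; apply/shift_dist_small => k km.
by rewrite negb_or !negbK !ww' ?eqxx//; lia.
Qed.

Lemma dist_window w w' m : shift_dist w w' < 2^-1 ^+ m :> R -> window m w w'.
Proof.
move=> /shift_dist_small nd k k_m.
have /nd : (`|k| <= m)%N by lia.
by rewrite negb_or !negbK; case: (intP k) => [|n|n] /andP[/eqP + /eqP].
Qed.

(** The windows, although not symmetric about 0, form a neighborhood basis. *)
Lemma nbhs_shiftP w U : nbhs w U <-> exists m, window m w `<=` U.
Proof.
rewrite -nbhs_ballE; split=> [[e /= e0 eU] | [m mU]].
  have [N _ /(_ N (leqnn N)) /= Ne] :
      \forall N \near \oo, 2^-1 ^+ N < e.
    have half1 : `|2^-1 : R| < 1 by rewrite ger0_norm ?invr_ge0 // invf_lt1 // ltr1n.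
    have /cvgrPdist_lt /(_ e e0) := cvg_expr half1.
    by apply: filterS => N; rewrite sub0r normrN ger0_norm // exprn_ge0 // invr_ge0.
  exists N.+1 => w' ww'; apply: eU; rewrite ballEmdist /=.
  exact: lt_trans (window_dist ww') Ne.
exists (2^-1 ^+ m) => /=; first by rewrite exprn_gt0 // invr_gt0.
move=> w'; rewrite ballEmdist /= => /dist_window ww'.
exact: mU.
Qed.

Lemma nbhs_window m w : nbhs w (window m w).
Proof. by apply/nbhs_shiftP; exists m. Qed.

Lemma nbhs_symbol w (k : int) : nbhs w [set w' : Sigma | w' k = w k].
Proof. by apply/nbhs_shiftP; exists `|k|.+1 => w' ww'; apply/esym/ww'; lia. Qed.

Lemma continuous_left_shift : continuous (@Defs.shift R s).
Proof.
move=> w U /nbhs_shiftP[m mU]; apply/nbhs_shiftP; exists m.+1 => w' ww'.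
by apply: mU => k k_m; apply: ww'; lia.
Qed.

(** Tychonoff for the finite alphabet: along an ultrafilter each coordinate is
    eventually constant. *)
Lemma compact_shift_space : compact [set: Sigma].
Proof.
rewrite compact_ultra => G GU _.
have [a Ga] : exists a : Sigma, forall k, G [set w | w k = a k].
  suff /choice[a Ga] k : exists i : 'I_s.+1, G [set w | w k = i] by exists a.
  apply: contrapT => /forallNP noi.
  have /filter_ex[w /(_ (w k))] // : \forall w \near G, forall i, w k <> i.
  apply: filter_forall => i.
  by have [/noi|] := in_ultra_setVsetC [set w : Sigma | w k = i] GU.
exists a; split=> // U /nbhs_shiftP[m mU].
have : \forall w \near G, forall i : 'I_(m + m),
    w (i%:Z - m%:Z) = a (i%:Z - m%:Z).
  by apply: filter_forall => i; exact: Ga.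
apply: filterS => w aw; apply: mU => k k_m.
have k_2m : (`|(k + m%:Z)%R| < m + m)%N by lia.
have := aw (Ordinal k_2m) => /=.
by rewrite (_ : `|(k + m%:Z)%R|%N%:Z - m%:Z = k) //; lia.
Qed.

End shift_topology.

(** * Lyapunov stability of past-saturated sets *)

Section skew_product_topology.
Context {R : realType} {s : nat} {M : ptopologicalType}.
Variable f : 'I_s.+1 -> M -> M.
Local Notation Sigma := (shift_space R s).
Local Notation X := (Sigma * M)%type.
Local Notation F := (@skew_product R s M f).
Implicit Types (x : X) (w : Sigma) (p : M) (A U V : set X).

Lemma iter_symbol x n k : (iter n F x).1 k = x.1 (k + n%:Z).
Proof.
elim: n k => [|n IHn] k /=; first by rewrite addr0.
by rewrite /Defs.shift IHn; congr (x.1 _); lia.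
Qed.

(** The past of the base point does not influence the future of the fiber
    coordinate; the whole argument rests on this. *)
Lemma iter_fiber n w w' p : agree 0 n%:Z w w' ->
  (iter n F (w, p)).2 = (iter n F (w', p)).2.
Proof.
elim: n => // n IHn ww' /=; rewrite IHn; last by move=> k kn; apply: ww'; lia.
by rewrite !iter_symbol /= ww' //; lia.
Qed.

(** The fiber map is locally constant in the base variable. *)
Lemma continuous_skew_product :
  (forall i, continuous (f i)) -> continuous F.
Proof.
move=> cf -[w p]; apply: (@cvg_pair _ _ _ _ (nbhs (Defs.shift w)) (nbhs (f (w 0) p))) => /=.
  move=> U /continuous_left_shift sU; exists (@Defs.shift R s @^-1` U, setT) => //=.
    by split=> //; exact: filterT.
  by move=> [w' p'] /= [].
move=> U /cf fU.
exists ([set w' : Sigma | w' 0 = w 0], f (w 0) @^-1` U) => /=.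
  by split=> //; exact: nbhs_symbol.
by move=> [w' p'] /= [-> ].
Qed.

Definition past_saturated A :=
  forall w w' p, A (w, p) -> agree_past w w' -> A (w', p).

Lemma iter_absorbed A : F @` A `<=` A -> forall n x, A x -> A (iter n F x).
Proof.
move=> FA; elim=> //= n IHn x /IHn Ax.
by apply: FA; exists (iter n F x).
Qed.

Lemma tube (K : set Sigma) p U : compact K ->
  (forall w, K w -> nbhs (w, p) U) -> \forall q \near p, forall w, K w -> U (w, q).
Proof.
move=> /compact_near_coveringP K_cover KU.
apply: (K_cover _ (nbhs p) (fun q w => U (w, q))) => w /KU.
by apply: filterS => -[].
Qed.

Lemma compact_same_past w : compact [set w' : Sigma | agree_past w w'].
Proof.
apply: subclosed_compact compact_shift_space _ => // w' cl_w' k k0.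
have [w'' [ww'' /= <-]] := cl_w' _ (nbhs_symbol w' k).
exact: ww''.
Qed.

(** Lebesgue number lemma in the base direction: compactness of A makes the
    length of the window uniform. *)
Lemma lebesgue_window A U : compact A -> set_nbhs A U ->
  exists m, forall w w' p, A (w, p) -> window m w w' -> U (w', p).
Proof.
move=> /compact_near_coveringP A_cover AU.
pose P m x := forall w', window m x.1 w' -> U (w', x.2).
suff /A_cover[m _ mU] : forall x, A x -> \forall x' \near x & m \near \oo, P m x'.
  by exists m => w w' p Ap ww'; exact: (mU m (leqnn m) (w, p)).
move=> [w p] /AU[[/= Q1 Q2] [/nbhs_shiftP[m mQ1] Q2p] QU].
exists ([set x | window m w x.1 /\ Q2 x.2], [set k | (m <= k)%N]) => /=.
  split; last by exists m.
  by exists (window m w, Q2) => //=; split=> //; exact: nbhs_window.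
move=> [[w1 p1] k] /= [[ww1 Q2p1] mk] w' w1w'.
apply: (QU (w', p1)); split=> //=; apply: mQ1 => i i_m.
by rewrite ww1 //; apply: w1w'; lia.
Qed.

(** From A to its projection, the past of a base point is exchanged for one
    that brings the point near A.  In the other direction, an orbit that stays near
    the projection has, after J steps, a base point whose last J symbols are
    those of a point of A, and the earlier symbols matter little. *)
Lemma lyapunov_stable_projection A : hausdorff_space M -> compact [set: M] ->
  (forall i, continuous (f i)) -> closed A -> F @` A `<=` A ->
  past_saturated A ->
  lyapunov_stable F A <-> lyapunov_stable F (setT `*` (snd @` A)).
Proof.
move=> hM cM cf clA FA satA.
have cF := continuous_skew_product cf.
have cA : compact A.
  apply: (@subclosed_compact _ _ (setT `*` setT)) => //.
  exact: compact_setX compact_shift_space cM.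
set B := setT `*` (snd @` A).
have AB : A `<=` B by move=> [w p] Awp; split=> //; exists (w, p).
have spliceA w w' p : A (w, p) -> A (splice w w', p).
  by move=> Awp; apply: satA Awp _ => k k0; rewrite /splice k0.
split=> -[_ _ stab]; split.
- have clpA : closed (snd @` A).
    apply: compact_closed hM _; apply: continuous_compact cA.
    by apply: continuous_subspaceT => x; exact: cvg_snd.
  rewrite (_ : B = snd @^-1` (snd @` A)); last first.
    by apply/seteqP; split=> x // -[].
  by apply: (preimage_closed _ clpA) => x _; exact: cvg_snd.
- move=> _ [[w p] [_ /= [[w' q] /[swap] /= -> Aw'p]] <-]; split=> //=.
  exists (F (splice w' w, p)); last by rewrite /= /splice ltxx.
  by apply: FA; exists (splice w' w, p) => //; exact: spliceA.
- move=> U BU.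
  pose U' := [set p | forall w, U (w, p)].
  have [V [AV VU V_stab]] : exists V, [/\ set_nbhs A V, V `<=` setT `*` U' &
      forall x, V x -> forall k, (setT `*` U') (iter k F x)].
    apply: stab => -[w p] Awp; exists (setT, U') => //=.
    split; first exact: filterT.
    have : \forall q \near p, forall w, setT w -> U (w, q).
      apply: (tube compact_shift_space) => w' _; apply: BU.
      by split=> //; exists (w, p).
    by apply: filterS => q qU w'; exact: qU.
  (* Tubes around the leaves of points with a common past: only the past of
     the base point has to be adjusted to enter V. *)
  pose Q := [set p | exists w, forall w', agree_past w w' -> V (w', p)].
  have QV w p : Q p -> exists2 w', V (w', p) & forall k, 0 <= k -> w k = w' k.
    move=> [w' w'V]; exists (splice w' w).
      by apply: w'V => k k0; rewrite /splice k0.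
    by move=> k k0; rewrite /splice ltNge k0.
  have QU w p : Q p -> forall k, U (iter k F (w, p)).
    move=> Qp k; have [w' Vw'p ww'] := QV w p Qp.
    have [_ /(_ (iter k F (w, p)).1)] := V_stab _ Vw'p k.
    rewrite -(@iter_fiber k w w'); first by rewrite -surjective_pairing.
    by move=> i /andP[i0 _]; exact: ww'.
  exists (setT `*` Q); split.
  + move=> [w p] [_ /= [[w' q] /[swap] /= -> Aw'p]]; exists (setT, Q) => //=.
    split; first exact: filterT.
    have := @tube _ p V (@compact_same_past w').
    move=> /(_ (fun w'' h => AV _ (satA _ _ _ Aw'p h))).
    by apply: filterS => p' p'V; exists w'.
  + by move=> [w p] [_ /= Qp]; exact: (QU w p Qp 0%N).
  + by move=> [w p] [_ /= Qp]; exact: QU.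
- exact: clA.
- exact: FA.
- move=> U AU.
  have [C [oC AC CU]] := (set_nbhsP A U).1 AU.
  have nC x : C x -> nbhs x C by move=> Cx; exact: open_nbhs_nbhs.
  have [J JC] := lebesgue_window cA (fun x Ax => nC x (AC x Ax)).
  (* The point of A is the J-th image of the point of B with its past replaced;
     saturation keeps the new point in A whatever the future is. *)
  have BC y : B y -> C (iter J F y).
    case: y => w q [_ /= [[w' p] /[swap] /= -> Aw'q]].
    have := iter_absorbed FA J (spliceA _ w _ Aw'q).
    rewrite (surjective_pairing (iter J F (splice w' w, _))).
    have -> : (iter J F (splice w' w, q)).2 = (iter J F (w, q)).2.
      by apply: iter_fiber => k /andP[k0 _]; rewrite /splice ltNge k0.
    rewrite (surjective_pairing (iter J F (w, q))) => /JC; apply => k k_J.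
    by rewrite !iter_symbol /= /splice ltNge (_ : 0 <= k + J%:Z) //; lia.
  have cFn n : continuous (iter n F).
    elim: n => [|n IHn] x; first exact: cvg_id.
    by apply: continuous_comp; [exact: IHn | exact: cF].
  have [V [BV _ V_stab]] := stab (iter J F @^-1` C)
    (fun x Bx => cFn J x _ (nC _ (BC x Bx))).
  exists [set x | V x /\ forall n : 'I_J, C (iter n F x)].
  have late x : V x -> (forall n : 'I_J, C (iter n F x)) -> forall k, U (iter k F x).
    move=> Vx Cx k; apply: CU; have [kJ|Jk] := ltnP k J; first exact: (Cx (Ordinal kJ)).
    by rewrite -(subnKC Jk) iterD; exact: V_stab.
  split.
  + move=> x Ax; apply: filterI; first exact/BV/AB.
    apply: (@filter_forall _ _ (fun (n : 'I_J) x => C (iter n F x)) (nbhs x)) => n.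
    apply: (cFn n x C); apply/nC/AC.
    exact: iter_absorbed.
  + by move=> x [Vx Cx]; exact: (late x Vx Cx 0%N).
  + by move=> x [Vx Cx]; exact: late.
Qed.

End skew_product_topology.

(** * Rarely visited sets and limit sets *)

Section rare_visits.
Context {X : Type} (F : X -> X).
Implicit Types (x : X) (U V : set X).

Definition visits x U (n : nat) : nat := \sum_(k < n) (iter k F x \in U).

Definition finitely_visited x U := \forall n \near \oo, ~ U (iter n F x).

Definition seldom_visited (R : realType) x U := forall e : R, 0 < e ->
  \forall n \near \oo, (visits x U n)%:R <= e * n%:R.

(** What the two notions of an orbit rarely visiting a set have in common: for
    each point, the rarely visited sets form an ideal that is stable under
    preimages by the dynamics. *)
Record rarity (rare : X -> set (set X)) : Prop := {
  rare0 : forall x, rare x set0;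
  rareS : forall x U V, U `<=` V -> rare x V -> rare x U;
  rareU : forall x U V, rare x U -> rare x V -> rare x (U `|` V);
  rare_preimage : forall x U, rare x U -> rare x (F @^-1` U) }.

Lemma finitely_visited_rarity : rarity finitely_visited.
Proof.
rewrite /finitely_visited; split=> [x|x U V UV|x U V|x U].
- by apply: nearW => n.
- by apply: filterS => n nV /UV.
- by apply: filterS2 => n nU nV [].
- by move=> [N _ NU]; exists N => // n /= Nn; apply: (NU n.+1); exact: leqW.
Qed.

Lemma visitsS x U n : visits x U n.+1 = (visits x U n + (iter n F x \in U))%N.
Proof. by rewrite /visits big_ord_recr. Qed.

Lemma leq_visits x U V n : U `<=` V -> (visits x U n <= visits x V n)%N.
Proof.
move=> UV; apply: leq_sum => k _.
have [/set_mem/UV/mem_set -> //|//] := boolP (_ \in U).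
Qed.

Lemma visitsU x U V n :
  (visits x (U `|` V) n <= visits x U n + visits x V n)%N.
Proof.
rewrite /visits -big_split; apply: leq_sum => k _ /=.
by rewrite in_setU; case: (_ \in U); case: (_ \in V).
Qed.

Lemma visits_preimage x U n : (visits x (F @^-1` U) n <= visits x U n.+1)%N.
Proof.
rewrite /visits big_ord_recl /=.
by apply: leq_trans (leq_addl _ _); apply: leq_sum.
Qed.

Lemma seldom_visited_rarity (R : realType) : rarity (@seldom_visited R).
Proof.
split=> [x|x U V UV Vrare|x U V Urare Vrare|x U Urare] e e0.
- apply: nearW => n; rewrite /visits big1 => [|k _]; last by rewrite in_set0.
  by rewrite mulr_ge0 // ltW.
- have := Vrare e e0; apply: filterS => n; apply: le_trans.
  by rewrite ler_nat leq_visits.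
- have e2 : 0 < e / 2 by rewrite divr_gt0.
  have := Vrare _ e2; have := Urare _ e2; apply: filterS2 => n Un Vn.
  have := visitsU x U V n; rewrite -(ler_nat R) natrD => /le_trans; apply.
  by rewrite [e]splitr mulrDl lerD.
- have e2 : 0 < e / 2 by rewrite divr_gt0.
  have [N _ NU] := Urare _ e2; exists N.+1 => // n /= Nn.
  have := visits_preimage x U n; rewrite -(ler_nat R) => /le_trans; apply.
  apply: le_trans (NU n.+1 _) _ => /=; first exact/ltnW/leqW.
  rewrite -mulrA ler_pM2l // mulrC ler_pdivrMr ?ltr0n // -natrM ler_nat; lia.
Qed.

End rare_visits.

Section limit_sets.
Context {X : topologicalType} (F : X -> X).
Implicit Types (x z : X) (U : set X).

Definition limit_set (rare : X -> set (set X)) (x : X) : set X :=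
  [set z | forall U, nbhs z U -> ~ rare x U].

Lemma omega_limitE : omega_limit F = limit_set (finitely_visited F).
Proof.
apply/funext => x; apply/seteqP; split=> z /= zL.
  move=> U zU Urare.
  by have [y []] := zL (~` U) U Urare zU.
move=> V U Vx zU; apply: contrapT => VU0; apply: (zL U zU).
have [N _ NV] := Vx; exists N => // n Nn Un.
by apply: VU0; exists (iter n F x); split=> //; exact: NV.
Qed.

(** The upper density of visits vanishes exactly when the density converges to
    zero. *)
Lemma Freq_gt0 (R : realType) x U :
  (0 < Freq F R x U)%E <-> ~ seldom_visited F R x U.
Proof.
rewrite /Freq; set u := fun N => _.
have u0 N : (0 <= u N)%E by rewrite lee_fin divr_ge0.
suff -> : seldom_visited F R x U <-> ~ (0 < limn_esup u)%E.
  by split=> [? //|]; exact: contrapT.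
have uE e n : (u n < e%:E)%E -> (visits F x U n)%:R <= e * n%:R.
  case: n => [|n]; first by rewrite /visits big_ord0 mulr0.
  by rewrite lte_fin ltr_pdivrMr ?ltr0n // => /ltW.
split=> [Urare|/negP].
  suff /cvg_limn_einf_sup[_ ->] : u @ \oo --> 0%E by rewrite ltxx.
  apply: cvg_EFin; first exact: nearW.
  apply/cvgrPdist_le => e e0; have := Urare e e0; apply: filterS => n un.
  rewrite sub0r normrN ger0_norm ?divr_ge0 //=.
  case: n un => [|n] un; first by rewrite invr0 mulr0 ltW.
  by rewrite ler_pdivrMr ?ltr0n.
rewrite -leNgt => /limn_esup_le_cvg/(_ u0) u_cvg e e0.
have /u_cvg[N _ Nu] : nbhs 0%E [set y | (y < e%:E)%E].
  by apply: open_nbhs_nbhs; split; [exact: open_ereal_lt_ereal | rewrite /= lte_fin].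
by exists N => // n /Nu; exact: uE.
Qed.

Lemma omega_statE (R : realType) :
  omega_stat F R = limit_set (seldom_visited F R).
Proof.
apply/funext => x; apply/seteqP; split=> z zL U /zL; by move/Freq_gt0.
Qed.

(** Compactness reformulated as a local-to-global principle for ideals of
    sets. *)
Lemma compact_ideal (I : set (set X)) (K : set X) : compact K ->
  I set0 -> (forall U V, U `<=` V -> I V -> I U) ->
  (forall U V, I U -> I V -> I (U `|` V)) ->
  (forall z, K z -> exists2 U, nbhs z U & I U) -> I K.
Proof.
move=> /compact_near_coveringP K_cover I0 IS IU KI.
pose G := filter_from I (fun U => [set V | U `<=` V]).
have GF : Filter G.
  apply: filter_from_filter; first by exists set0.
  move=> U V IcU IcV; exists (U `|` V); first exact: IU.
  by move=> W /=; rewrite subUset.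
have [z Kz|U IcU /(_ U (@subset_refl _ U)) KU] := K_cover _ G (fun V z => V z) GF.
  have [U zU IcU] := KI z Kz.
  exists (U, [set V | U `<=` V]) => /=; first by split=> //; exists U.
  by move=> [z' V] /= [Uz']; exact.
exact: IS KU IcU.
Qed.

Lemma limit_set_image rare x : rarity F rare -> continuous F ->
  F @` limit_set rare x `<=` limit_set rare x.
Proof.
move=> rF cF _ [z zL <-] U FzU Urare.
by apply: (zL (F @^-1` U)); [exact: cF | exact: rare_preimage rF _ _ _].
Qed.

Lemma rare_compact rare x K : rarity F rare -> compact K ->
  K `&` limit_set rare x `<=` set0 -> rare x K.
Proof.
move=> rF cK KL; apply: (compact_ideal cK).
- exact: rare0 rF _.
- by move=> U V; exact: rareS rF _ _ _.
- by move=> U V; exact: rareU rF _ _ _.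
move=> z Kz; apply: contrapT => noU; apply: (KL z); split=> // U zU Urare.
by apply: noU; exists U.
Qed.

End limit_sets.

(** * Past saturation of the almost sure hull of limit sets *)

Section saturation.
Context {R : realType} {s : nat} {M : ptopologicalType}.
Local Notation Sigma := (shift_space R s).
Local Notation X := (Sigma * M)%type.
Variables (F : X -> X) (mu : {measure set (borel Sigma * borel M) -> \bar R}).
Implicit Types (rare : X -> set (set X)) (B : set M) (w : Sigma).

Lemma ae_mono (P Q : X -> Prop) : (forall x, P x -> Q x) ->
  {ae mu, forall x, P x} -> {ae mu, forall x, Q x}.
Proof. by move=> PQ; apply: (@filterS _ _ (ae_filter_ringOfSetsType mu)). Qed.

Definition box (m h : nat) w B : set X :=
  [set x | agree (- m%:Z) h%:Z w x.1 /\ B x.2].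

(** The box at length h.+1 differs from the one at length h by a condition on
    the symbol at position h alone, which is independent of the condition
    defining the latter. *)
Definition future_free rare := forall m h w B, open B ->
  {ae mu, forall x, rare x (box m h.+1 w B)} ->
  {ae mu, forall x, rare x (box m h w B)}.

Lemma future_free0 rare : future_free rare -> forall m h w B, open B ->
  {ae mu, forall x, rare x (box m h w B)} ->
  {ae mu, forall x, rare x (box m 0 w B)}.
Proof.
by move=> ff m; elim=> // h IHh w B oB /(ff _ _ _ _ oB); exact: IHh.
Qed.

Lemma open_agree lo hi w : open [set w' : Sigma | agree lo hi w w'].
Proof.
rewrite openE => w' ww'; apply/nbhs_shiftP.
exists (`|lo| + `|hi|)%N.+1 => w'' w'w'' k k_in.
by rewrite ww' //; apply: w'w''; lia.
Qed.

Lemma closed_agree lo hi w : closed [set w' : Sigma | agree lo hi w w'].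
Proof.
move=> w' cl_w' k k_in.
have [w'' [ww'' /= <-]] := cl_w' _ (nbhs_symbol w' k).
exact: ww''.
Qed.

Lemma open_box m h w B : open B -> open (box m h w B).
Proof.
move=> oB; rewrite openE => -[w' p] [/= ww' Bp].
exists ([set w' | agree (- m%:Z) h%:Z w w'], B) => //=; split.
  by apply: open_nbhs_nbhs; split=> //; exact: open_agree.
exact: open_nbhs_nbhs.
Qed.

Lemma ae_hull_absorbed rare : rarity F rare -> continuous F ->
  F @` ae_hull mu (limit_set rare) `<=` ae_hull mu (limit_set rare).
Proof.
move=> rF cF _ [x hx <-] A [clA LA].
apply: (hx (F @^-1` A)); split; first by apply: preimage_closed clA => y _; exact: cF.
move: LA; apply: ae_mono => y LA z Lz; apply: LA.
by apply: (limit_set_image rF cF); exists z.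
Qed.

Lemma closed_ae_hull (L : X -> set X) : closed (ae_hull mu L).
Proof. by apply: closed_bigI => A []. Qed.

(** Otherwise some closed A containing almost all limit sets misses a compact
    box around (w', p); this box is almost surely rarely visited, and so is
    the one where the future is not prescribed.  The complement of the latter then
    contains almost all limit sets but not (w, p). *)
Lemma ae_hull_past_saturated rare : hausdorff_space M -> compact [set: M] ->
  rarity F rare -> future_free rare ->
  past_saturated (ae_hull mu (limit_set rare)).
Proof.
move=> hM cM rF ff w w' p hwp ww' A [clA LA]; apply: contrapT => nA.
have [[/= Q1 Q2] [/nbhs_shiftP[m mQ1] Q2p] QA] : nbhs (w', p) (~` A).
  by apply: open_nbhs_nbhs; split=> //; exact: closed_openC.
have [B [oB Bp BQ2]] : exists B, [/\ open B, B p & closure B `<=` Q2].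
  have [B' pB' B'Q2] := compact_regular hM cM (filterT : nbhs p setT) Q2p.
  move: pB'; rewrite nbhsE => -[B [oB Bp] BB']; exists B; split=> //.
  exact: subset_trans (closureS BB') B'Q2.
pose K := box m m w' (closure B).
have cK : compact K.
  apply: (@subclosed_compact _ _ (setT `*` setT)) => //; last first.
    exact: compact_setX compact_shift_space cM.
  rewrite (_ : K = fst @^-1` [set v | agree (- m%:Z) m%:Z w' v] `&`
                   snd @^-1` closure B); last by apply/seteqP; split.
  apply: closedI; first by apply: preimage_closed (@closed_agree _ _ _) => x _; exact: cvg_fst.
  by apply: preimage_closed (@closed_closure _ _) => x _; exact: cvg_snd.
have KA : K `<=` ~` A.
  by move=> [v q] /= [w'v /BQ2 Q2q]; apply: QA; split=> //; exact: mQ1.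
have : {ae mu, forall x, rare x (box m m w' B)}.
  move: LA; apply: ae_mono => x LxA.
  apply: (rareS rF) (rare_compact rF cK _).
    by move=> y [w'y /subset_closure].
  by move=> y [/KA nAy /LxA].
move=> /(future_free0 ff oB) rare0.
have : (~` box m 0 w B) (w, p).
  apply: hwp; split; first exact/open_closedC/open_box.
  move: rare0; apply: ae_mono => x rx z Lz wz; apply: (Lz _ _ rx).
  apply: open_nbhs_nbhs; split; first exact: open_box.
  case: wz => wz Bz; split=> // k k_in; rewrite -ww' ?wz //; lia.
by apply.
Qed.

End saturation.

(** * Sequences of nonnegative functions with bounded integrals *)

Section bounded_in_mean.
Context d (T : measurableType d) (R : realType).
Variables (mu : {measure set T -> \bar R}) (Z : nat -> T -> R) (C : R).
Hypothesis mZ : forall n, measurable_fun setT (Z n).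
Hypothesis Z0 : forall n x, 0 <= Z n x.
Hypothesis Z_le : forall n, (\int[mu]_x (Z n x)%:E <= C%:E)%E.

Let mEZ n : measurable_fun setT (fun x => (Z n x)%:E).
Proof. exact/measurable_EFinP. Qed.

Let EZ0 n x : setT x -> (0 <= (Z n x)%:E)%E.
Proof. by rewrite lee_fin. Qed.

Lemma ae_finite (g : T -> \bar R) : measurable_fun setT g ->
  (forall x, 0 <= g x)%E -> (\int[mu]_x g x < +oo)%E ->
  {ae mu, forall x, (g x < +oo)%E}.
Proof.
move=> mg g0 intg.
have /(integrable_ae measurableT) : mu.-integrable setT g.
  apply/integrableP; split=> //.
  by rewrite (eq_integral g) // => x _; rewrite gee0_abs.
by apply: filterS => x /(_ I); rewrite fin_numE => /andP[_]; rewrite -ltey.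
Qed.

(** By Fatou's lemma the inferior limit of the sequence is integrable. *)
Lemma ae_liminf_bounded :
  {ae mu, forall x, exists A, forall N, exists2 n, (N <= n)%N & Z n x <= A}.
Proof.
pose g x := limn_einf (fun n => (Z n x)%:E).
have mg : measurable_fun setT g.
  apply: measurableT_comp => //; apply: measurable_fun_limn_esup => n.
  exact: measurableT_comp.
have g0 x : (0 <= g x)%E.
  rewrite /g limn_einf_lim; apply: lime_ge; first exact: is_cvg_einfs.
  apply: nearW => n; apply: le_ereal_inf_tmp => _ [k _ <-].
  by rewrite lee_fin.
have gfin : (\int[mu]_x g x < +oo)%E.
  apply: le_lt_trans (fatou mu measurableT mEZ EZ0) _.
  apply: le_lt_trans (limn_einf_sup _) _; apply: le_lt_trans (ltry C).
  rewrite limn_esup_lim; apply: lime_le; first exact: is_cvg_esups.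
  by apply: nearW => n; apply: ge_ereal_sup => _ [k _ <-].
have := ae_finite mg g0 gfin; apply: filterS => x gx; apply: contrapT => noA.
suff Zoo : (Z n x)%:E @[n --> \oo] --> +oo%E.
  by move: gx; rewrite /g (cvg_limn_einf_sup Zoo).1 ltxx.
apply/cvgeyPge => A; apply: contrapT => ZA; apply: noA; exists A => N.
apply: contrapT => noN; apply: ZA; exists N => // n /= Nn.
rewrite lee_fin leNgt; apply/negP => /ltW ZnA.
by apply: noN; exists n.
Qed.

(** The series of the t ^+ n * Z n has a finite integral, and dominates each of
    its terms. *)
Lemma ae_geometric_bounded (t : R) : 0 < t < 1 ->
  {ae mu, forall x, exists Y, forall n, t ^+ n * Z n x <= Y}.
Proof.
move=> /andP[t0 t1].
pose u n x := (t ^+ n * Z n x)%:E.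
have u0 n x : (0 <= u n x)%E by rewrite lee_fin mulr_ge0 // exprn_ge0 // ltW.
have mu_ n : measurable_fun setT (u n).
  by apply/measurable_EFinP; exact: measurable_funM.
pose g x := (\sum_(n <oo) u n x)%E.
have mg : measurable_fun setT g.
  exact: (@ge0_emeasurable_sum _ _ _ setT u xpredT).
have g0 x : (0 <= g x)%E by exact: nneseries_ge0.
have C0 : 0 <= C.
  by rewrite -lee_fin; apply: le_trans (Z_le 0); apply: integral_ge0 => x; exact: EZ0.
have gfin : (\int[mu]_x g x < +oo)%E.
  rewrite integral_nneseries //; apply: le_lt_trans (ltry (C * (1 - t)^-1)).
  apply: lime_le; first by apply: is_cvg_nneseries => n _ _; apply: integral_ge0.
  apply: nearW => N; have t1n : `|t| < 1 by rewrite ger0_norm // ltW.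
  have := geometric_le_lim N C0 t0 t1n; rewrite -lee_fin; apply: le_trans.
  rewrite /series /= -sumEFin; apply: lee_sum => n _.
  rewrite /u; under eq_integral do rewrite EFinM.
  have tn0 : 0 <= t ^+ n by rewrite exprn_ge0 // ltW.
  rewrite (ge0_integralZl_EFin _ measurableT (@EZ0 n) (mEZ n) tn0).
  rewrite mulrC EFinM; apply: lee_wpmul2l (Z_le n).
  by rewrite lee_fin.
have := ae_finite mg g0 gfin; apply: filterS => x gx.
exists (fine (g x)) => n; rewrite -lee_fin fineK; last by rewrite ge0_fin_numE.
apply: le_trans (nneseries_lim_ge n.+1 (fun k _ _ => u0 k x)).
by rewrite big_nat_recr //= leeDr // sume_ge0.
Qed.

End bounded_in_mean.

(** * Independence of symbols under the Bernoulli measure *)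

Section bernoulli.
Context {R : realType} {s : nat}.
Local Notation Sigma := (shift_space R s).
Variable muS : probability (borel Sigma) R.
Hypothesis muS_bernoulli : is_uniform_bernoulli muS.
Implicit Types (w : Sigma) (K : seq int).

Lemma borel_open (T : ptopologicalType) (U : set T) :
  open U -> measurable (U : set (borel T)).
Proof. exact: sub_sigma_algebra. Qed.

Lemma continuous_borel (T T' : ptopologicalType) (g : T -> T') :
  continuous g -> measurable_fun setT (g : borel T -> borel T').
Proof.
move=> cg; apply: (@measurability _ _ (borel T) (borel T') setT g (@open T')) => //.
move=> _ [U oU <-]; rewrite setTI; apply: borel_open.
by move/continuousP : cg; exact.
Qed.

(** A word at the positions K as a point of the shift space, so that functions
    of the coordinates in K can be evaluated at it. *)
Definition word_extension K (u : (size K).-tuple 'I_s.+1) : Sigma :=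
  fun k => nth ord0 u (index k K).

Definition cylinder K (v : Sigma) : set Sigma :=
  [set w | forall k, k \in K -> w k = v k].

Lemma measurable_cylinder K v : measurable (cylinder K v : set (borel Sigma)).
Proof.
apply: borel_open; rewrite openE => w wv; apply/nbhs_shiftP.
exists (\max_(k <- K) `|k|%N).+1 => w' ww' k kK; rewrite -wv //.
apply/esym/ww'; have : (`|k| <= \max_(k <- K) `|k|)%N.
  exact: (@leq_bigmax_seq _ _ xpredT absz).
lia.
Qed.

Lemma word_decomposition K (h : Sigma -> R) : uniq K ->
  (forall w w', (forall k, k \in K -> w k = w' k) -> h w = h w') ->
  forall w, h w =
    \sum_(u : (size K).-tuple 'I_s.+1)
       h (word_extension u) * \1_(cylinder K (word_extension u)) w.
Proof.
move=> uK hK w; pose u := [tuple of map w (in_tuple K)] : (size K).-tuple 'I_s.+1.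
have wu k : k \in K -> w k = word_extension u k.
  by move=> kK; rewrite /word_extension (nth_map 0) ?index_mem ?nth_index.
rewrite (bigD1 u) //= big1 ?addr0 => [|v vu].
  by rewrite (hK w _ wu) indicE mem_set ?mulr1.
rewrite indicE memNset ?mulr0 // => wv; case/eqP: vu.
apply: eq_from_tnth => i; rewrite !(tnth_nth ord0) /= (nth_map 0) //.
by rewrite wv ?mem_nth // /word_extension index_uniq.
Qed.

Lemma integral_words K (h : Sigma -> R) (B : set (borel Sigma)) (r : R) :
  uniq K -> (forall w w', (forall k, k \in K -> w k = w' k) -> h w = h w') ->
  (forall w, 0 <= h w) -> measurable B ->
  (forall u : (size K).-tuple 'I_s.+1,
     muS (cylinder K (word_extension u) `&` B) = r%:E) ->
  (\int[muS]_w (h w * \1_B w)%:E =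
   (r * \sum_(u : (size K).-tuple 'I_s.+1) h (word_extension u))%:E)%E.
Proof.
move=> uK hK h0 mB muSB.
pose C u : set (borel Sigma) := cylinder K (@word_extension K u) `&` B.
have mC u : measurable (C u) by apply: measurableI => //; exact: measurable_cylinder.
transitivity (\int[muS]_w (\sum_(u : (size K).-tuple 'I_s.+1)
    (h (word_extension u) * \1_(C u) w)%:E))%E.
  apply: eq_integral => w _; rewrite [in LHS](word_decomposition uK hK) mulr_suml.
  by rewrite sumEFin; congr EFin; apply: eq_bigr => u _; rewrite indicI -mulrA.
rewrite ge0_integral_sum //; last 2 first.
- move=> u; apply/measurable_EFinP; exact: measurable_funM.
- by move=> u w _; rewrite lee_fin mulr_ge0.
rewrite mulr_sumr -sumEFin; apply: eq_bigr => u _.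
under eq_integral do rewrite EFinM.
rewrite ge0_integralZl_EFin //; last exact/measurable_EFinP.
rewrite integral_indic // setIT mulrC EFinM; congr (_ * _)%E; exact: muSB.
Qed.

(** The symbol at position j is uniform and independent of the symbols at the
    positions in K. *)
Lemma integral_fresh_symbol K j (h : Sigma -> R) (theta : 'I_s.+1 -> R) :
  uniq (j :: K) ->
  (forall w w', (forall k, k \in K -> w k = w' k) -> h w = h w') ->
  (forall w, 0 <= h w) -> (forall c, 0 <= theta c) ->
  (\int[muS]_w (h w * theta (w j))%:E =
   (s.+1%:R^-1 * \sum_c theta c)%:E * \int[muS]_w (h w)%:E)%E.
Proof.
move=> ujK hK h0 t0; have [jK uK] := andP ujK.
pose J c : set (borel Sigma) := [set w : Sigma | w j = c].
have mJ c : measurable (J c).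
  rewrite (_ : J c = cylinder [:: j] (fun=> c)); first exact: measurable_cylinder.
  apply/seteqP; split=> w; last by apply; rewrite inE.
  by move=> wjc k; rewrite inE => /eqP ->.
pose H := \sum_(u : (size K).-tuple 'I_s.+1) h (word_extension u).
have intJ c : (\int[muS]_w (h w * \1_(J c) w)%:E =
    (s.+1%:R^-1 ^+ (size K).+1 * H)%:E)%E.
  apply: integral_words => // u.
  rewrite (_ : _ `&` _ = [set w : Sigma | forall k, k \in j :: K ->
      w k = (if k == j then c else word_extension u k)]).
    exact: (muS_bernoulli _ ujK).
  apply/seteqP; split=> w /=.
    move=> [wu wj] k; rewrite inE; case: eqP => [-> //|_ /=]; exact: wu.
  move=> wu; split=> [k kK|].
    by rewrite wu ?inE ?kK ?orbT // ifN //; apply: contraNneq jK => <-.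
  by rewrite /J /= wu ?inE ?eqxx.
have intT : (\int[muS]_w (h w)%:E = (s.+1%:R^-1 ^+ size K * H)%:E)%E.
  rewrite -(integral_words (B := setT)) //.
    by apply: eq_integral => w _; rewrite indicT mulr1.
  by move=> u; rewrite setIT; exact: (muS_bernoulli _ uK).
rewrite intT -EFinM.
transitivity (\int[muS]_w (\sum_c (theta c)%:E * (h w * \1_(J c) w)%:E))%E.
  apply: eq_integral => w _; rewrite (bigD1 (w j)) //= big1 ?adde0 => [|c cw].
    by rewrite -EFinM indicE mem_set // mulr1 mulrC.
  by rewrite indicE memNset ?mulr0 ?mule0 // => wjc; case/eqP: cw.
have mh c : measurable_fun setT (fun w : borel Sigma => (h w * \1_(J c) w)%:E).
  apply/measurable_EFinP; apply: measurable_funM; last exact: measurable_indic.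
  rewrite (funext (word_decomposition uK hK)); apply: measurable_sum => u.
  apply: measurable_funM => //; apply: measurable_indic; exact: measurable_cylinder.
rewrite ge0_integral_sum //; last 2 first.
- by move=> c; exact: measurable_funeM.
- by move=> c w _; rewrite -EFinM lee_fin !mulr_ge0.
transitivity (\sum_c (theta c * (s.+1%:R^-1 ^+ (size K).+1 * H))%:E)%E.
  apply: eq_bigr => c _; rewrite ge0_integralZl_EFin ?intJ //.
  by move=> w _; rewrite lee_fin mulr_ge0.
by rewrite sumEFin -mulr_suml exprS; congr EFin; ring.
Qed.

End bernoulli.

(** * The wealth of a gambler betting on the next symbol *)

Section wealth.
Context {R : realType} {s : nat} {M : ptopologicalType}.
Local Notation Sigma := (shift_space R s).
Local Notation X := (Sigma * M)%type.
Variable f : 'I_s.+1 -> M -> M.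
Hypothesis cf : forall i, continuous (f i).
Local Notation F := (@skew_product R s M f).
Implicit Types (x : X) (w v : Sigma) (p : M) (B : set M).

(** The gambler wins odds - 1 per unit on a successful bet and loses half of
    the wealth otherwise.  With q the probability of losing, the mean
    multiplier is q / 2 + (1 - q) * (1 + q / 2) = 1 - q ^+ 2 / 2; the choice
    also works when q = 1, that is, for a single symbol. *)
Definition odds : R := 1 + s.+1%:R^-1 / 2.

(** A bet is placed at each visit to G and lost at each visit to G', a subset of
    G: the wealth is multiplied by odds in the first case, and by a further
    factor 1 / (2 * odds) in the second. *)
Definition wealth (G G' : set X) (n : nat) x : R :=
  odds ^+ visits F x G n * (2 * odds) ^- visits F x G' n.

Lemma odds_gt1 : 1 < odds.
Proof. by rewrite ltrDl divr_gt0 // invr_gt0. Qed.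

Lemma odds_gt0 : 0 < odds.
Proof. exact: lt_trans odds_gt1. Qed.

Lemma wealth_ge0 G G' n x : 0 <= wealth G G' n x.
Proof.
by rewrite mulr_ge0 ?exprn_ge0 ?invr_ge0 ?exprn_ge0 ?mulr_ge0 // ltW ?odds_gt0.
Qed.

Lemma wealthE G G' n x :
  wealth G G' n x * (2 * odds) ^+ visits F x G' n = odds ^+ visits F x G n.
Proof.
by rewrite mulfVK // expf_neq0 // mulf_neq0 // gt_eqF // odds_gt0.
Qed.

Definition gain (i : 'I_s.+1) (c : 'I_s.+1) : R := if c == i then 2^-1 else odds.

Lemma gain_fair i : s.+1%:R^-1 * \sum_c gain i c <= 1.
Proof.
rewrite (bigD1 i) //= {1}/gain eqxx (eq_bigr (fun=> odds)) => [|c /negPf ci].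
  rewrite sumr_const cardC1 card_ord /= -[X in _ + X]mulr_natr /odds.
  have s1 : s.+1%:R != 0 :> R by [].
  set q := s.+1%:R^-1; have qs : q * s%:R = 1 - q.
    by rewrite -[s%:R](addrK 1) natr1 mulrBr /q mulVf // mulr1.
  rewrite (_ : _ * _ = q / 2 + (q * s%:R) * (1 + q / 2)); last by ring.
  rewrite qs; have : 0 <= q ^+ 2 by exact: sqr_ge0.
  rewrite expr2; lra.
by rewrite /gain ci.
Qed.

Lemma gain_ge0 i c : 0 <= gain i c.
Proof. by rewrite /gain; case: ifP => _; rewrite ?invr_ge0 // ltW ?odds_gt0. Qed.

Lemma wealth_boxS m h v B n x :
  wealth (box m h v B) (box m h.+1 v B) n.+1 x =
  wealth (box m h v B) (box m h.+1 v B) n x *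
    (if iter n F x \in box m h v B then gain (v h) (x.1 (h + n)%N) else 1).
Proof.
rewrite /wealth !visitsS !exprD invfM mulrACA; congr (_ * _).
have o0 : odds != 0 by rewrite gt_eqF // odds_gt0.
have -> : (iter n F x \in box m h.+1 v B) =
    (iter n F x \in box m h v B) && (x.1 (h + n)%N == v h).
  have xn : (iter n F x).1 h = x.1 (h + n)%N by rewrite iter_symbol PoszD.
  apply/idP/andP => [/set_mem[vx Bx]|[/set_mem[vx Bx] /eqP vh]].
    split; first by apply/mem_set; split=> // k k_in; apply: vx; lia.
    by rewrite -xn vx //; lia.
  apply/mem_set; split=> // k k_in.
  have [->|kh] := eqVneq k h%:Z; first by rewrite xn.
  by apply: vx; lia.
case: (_ \in _) => /=; last by rewrite !expr0 invr1 mulr1.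
rewrite /gain; case: eqP => _; last by rewrite expr1 expr0 invr1 mulr1.
by rewrite !expr1 invfM mulrCA divff // mulr1.
Qed.

(** The wealth at time n, and whether a bet is placed then, are determined by
    symbols at positions before n + h, where the symbol deciding this bet is. *)
Lemma iter_local m h n w w' p :
  agree (- m%:Z) (n + h)%N w w' ->
  agree (- m%:Z) h (iter n F (w, p)).1 (iter n F (w', p)).1 /\
  (iter n F (w, p)).2 = (iter n F (w', p)).2.
Proof.
move=> ww'; split=> [k k_in|]; last by apply: iter_fiber => k k_in; apply: ww'; lia.
by rewrite !iter_symbol /=; apply: ww'; lia.
Qed.

Lemma box_local m h v B n w w' p :
  agree (- m%:Z) (n + h)%N w w' ->
  (iter n F (w, p) \in box m h v B) = (iter n F (w', p) \in box m h v B).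
Proof.
move=> /(iter_local p)[nn' e]; apply/idP/idP => /set_mem[vw Bp]; apply/mem_set.
  by split=> [k k_in|]; [rewrite vw // nn' | rewrite -e].
by split=> [k k_in|]; [rewrite vw // nn' | rewrite e].
Qed.

Lemma wealth_local m h v B n w w' p :
  agree (- m%:Z) (n + h)%N w w' ->
  wealth (box m h v B) (box m h.+1 v B) n (w, p) =
  wealth (box m h v B) (box m h.+1 v B) n (w', p).
Proof.
elim: n => [|n IHn] ww'; first by rewrite /wealth /visits !big_ord0.
have ww'n : agree (- m%:Z) (n + h)%N w w' by move=> k k_in; apply: ww'; lia.
rewrite !wealth_boxS IHn // (box_local _ _ _ ww'n) /= ww' //; lia.
Qed.

Lemma measurable_skew_product :
  measurable_fun setT (F : borel Sigma * borel M -> borel Sigma * borel M).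
Proof.
have mshift : measurable_fun setT
    (fun x : borel Sigma * borel M => Defs.shift x.1 : borel Sigma).
  apply: (measurableT_comp (continuous_borel (@continuous_left_shift R s))).
  exact: measurable_fst.
suff mfiber : measurable_fun setT
    (fun x : borel Sigma * borel M => f (x.1 0) x.2 : borel M).
  exact: measurable_fun_pair mshift mfiber.
move=> _ C mC; rewrite setTI.
rewrite (_ : _ @^-1` _ =
    \bigcup_(i in [set: 'I_s.+1]) ([set w : Sigma | w 0 = i] `*` (f i @^-1` C))).
  apply: fin_bigcup_measurable => // i _; apply: measurableX.
    rewrite (_ : mkset _ = cylinder [:: 0] (fun=> i)).
      exact: measurable_cylinder.
    apply/seteqP; split=> w; last by apply; rewrite inE.
    by move=> w0i k; rewrite inE => /eqP ->.
  rewrite -[X in measurable X]setTI; exact: (continuous_borel (@cf i) measurableT mC).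
apply/seteqP; split=> -[w p]; first by exists (w 0).
by move=> [i _ [/= <-]].
Qed.

Lemma measurable_iter n :
  measurable_fun setT (iter n F : borel Sigma * borel M -> borel Sigma * borel M).
Proof.
elim: n => [|n IHn]; first exact: measurable_id.
exact: measurableT_comp measurable_skew_product IHn.
Qed.

Lemma measurable_box m h v B : open B ->
  measurable (box m h v B : set (borel Sigma * borel M)).
Proof.
move=> oB; apply: (measurableX (A := [set w : borel Sigma | agree (- m%:Z) h v w])
  (B := B : set (borel M))).
  exact: (borel_open (@open_agree R s _ _ v)).
exact: borel_open.
Qed.

Lemma measurable_visited n (G : set (borel Sigma * borel M)) : measurable G ->
  measurable (iter n F @^-1` G : set (borel Sigma * borel M)).
Proof.
by move=> mG; rewrite -[X in measurable X]setTI; exact: measurable_iter.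
Qed.

Lemma measurable_wealth (G G' : set (borel Sigma * borel M)) n :
  measurable G -> measurable G' ->
  measurable_fun setT (wealth G G' n : borel Sigma * borel M -> R).
Proof.
move=> mG mG'; elim: n => [|n IHn].
  rewrite (_ : wealth G G' 0 = cst 1); first exact: measurable_cst.
  by apply/funext => x; rewrite /wealth /visits !big_ord0 expr0 invr1 mulr1.
have -> : wealth G G' n.+1 = fun x => wealth G G' n x *
   ((1 + (odds - 1) * \1_(iter n F @^-1` G) x) *
    (1 + ((2 * odds)^-1 - 1) * \1_(iter n F @^-1` G') x)).
  apply/funext => x; rewrite /wealth !visitsS !exprD invfM mulrACA; congr (_ * (_ * _)).
    have -> : (\1_(iter n F @^-1` G) x : R) = (iter n F x \in G)%:R.
      by rewrite indicE; congr (_%:R); apply/idP/idP => /set_mem h; apply/mem_set.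
    by case: (_ \in _) => /=; rewrite ?expr1 ?expr0; ring.
  have -> : (\1_(iter n F @^-1` G') x : R) = (iter n F x \in G')%:R.
    by rewrite indicE; congr (_%:R); apply/idP/idP => /set_mem h; apply/mem_set.
  by case: (_ \in _) => /=; rewrite ?expr1 ?expr0 ?invr1; ring.
have m_affine (b : R) (E : set (borel Sigma * borel M)) : measurable E ->
    measurable_fun setT (fun x : borel Sigma * borel M => 1 + b * \1_E x : R).
  by move=> mE; apply: measurable_funD => //; exact: measurable_funM.
apply: measurable_funM => //; apply: measurable_funM; apply: m_affine;
  exact: measurable_visited.
Qed.

End wealth.

(** * The mean wealth is bounded *)

Section future_free.
Context {R : realType} {s : nat} {M : ptopologicalType}.
Local Notation Sigma := (shift_space R s).
Local Notation X := (Sigma * M)%type.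
Variables (f : 'I_s.+1 -> M -> M) (muS : probability (borel Sigma) R).
Variable vol : {finite_measure set (borel M) -> \bar R}.
Hypothesis cf : forall i, continuous (f i).
Hypothesis muS_bernoulli : is_uniform_bernoulli muS.
Local Notation F := (@skew_product R s M f).
Local Notation mu := (muS \x vol)%E.

Section fixed_box.
Variables (m h : nat) (v : Sigma) (B : set M).
Hypothesis oB : open B.
Let G : set (borel Sigma * borel M) := box m h v B.
Let G' : set (borel Sigma * borel M) := box m h.+1 v B.
Let Z n : borel Sigma * borel M -> R := wealth f G G' n.

Let mG : measurable G. Proof. exact: measurable_box. Qed.
Let mG' : measurable G'. Proof. exact: measurable_box. Qed.
Let mZ n : measurable_fun setT (Z n). Proof. exact: measurable_wealth. Qed.

Let mZ1 n p : measurable_fun setT (fun w : borel Sigma => Z n (w, p)).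
Proof. exact: measurable_fun_pair1. Qed.

Let window_list n : seq int := [seq k%:Z - m%:Z | k <- iota 0 (m + (n + h))].

Let mem_window_list n (k : int) : (k \in window_list n) = (- m%:Z <= k < (n + h)%N).
Proof.
apply/mapP/idP => [[i]|k_in]; first by rewrite mem_iota => i_in ->; lia.
exists `|(k + m%:Z)%R|%N; last by lia.
by rewrite mem_iota; lia.
Qed.

Let uniq_window_list n : uniq ((n + h)%N%:Z :: window_list n).
Proof.
rewrite /= mem_window_list map_inj_uniq ?iota_uniq ?andbT; first by lia.
by move=> i j /=; lia.
Qed.

(** When a bet is placed, it is decided by a fresh symbol; otherwise the wealth
    does not change. *)
Lemma integral_wealthS n p :
  (\int[muS]_w (Z n.+1 (w, p))%:E <= \int[muS]_w (Z n (w, p))%:E)%E.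
Proof.
pose E : set (borel Sigma) := [set w | iter n F (w, p) \in G].
have mE : measurable E.
  rewrite (_ : E = setT `&` (fun w : borel Sigma => iter n F (w, p)) @^-1` G).
    exact: (measurable_fun_pair1 p (measurable_iter cf n) measurableT mG).
  by apply/seteqP; split=> w; rewrite setTI /E /= inE.
have inE_ w : (w \in E) = (iter n F (w, p) \in G).
  by apply/idP/idP => [/set_mem|/mem_set].
have Z0 k w : 0 <= Z k (w, p) by exact: wealth_ge0.
have localP (w w' : Sigma) : (forall k, k \in window_list n -> w k = w' k) ->
    agree (- m%:Z) (n + h)%N w w'.
  by move=> ww' k k_in; apply: ww'; rewrite mem_window_list.
pose a w := Z n (w, p) * \1_E w.
pose b w := Z n (w, p) * (1 - \1_E w).
have E1 w : 0 <= 1 - \1_E w :> R by rewrite indicE; case: (_ \in _); rewrite ?subr0 ?subrr.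
have ma : measurable_fun setT (EFin \o a).
  by apply/measurable_EFinP; exact: measurable_funM.
have mb : measurable_fun setT (EFin \o b).
  by apply/measurable_EFinP; apply: measurable_funM => //; exact: measurable_funB.
have mZj : measurable_fun setT
    (fun w : borel Sigma => (Z n.+1 (w, p))%:E) by exact/measurable_EFinP.
have a0 w : 0 <= a w by rewrite mulr_ge0.
have b0 w : 0 <= b w by rewrite mulr_ge0.
have ZSE w : Z n.+1 (w, p) = b w + a w * gain (v h) (w (n + h)%N).
  rewrite /Z wealth_boxS /a /b indicE inE_ /= (addnC n) -/(Z n (w, p)) -/G.
  by case: (_ \in G); rewrite /= ?subrr ?subr0 ?mulr1 ?mulr0 ?mul0r ?add0r ?addr0.
have ZE w : Z n (w, p) = b w + a w by rewrite /a /b; ring.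
have mag : measurable_fun setT
    (fun w : borel Sigma => (a w * gain (v h) (w (n + h)%N))%:E).
  rewrite (_ : (fun _ => _) = fun w => (Z n.+1 (w, p) - b w)%:E).
    apply/measurable_EFinP; apply: measurable_funB => //.
    exact/measurable_EFinP.
  by apply/funext => w; rewrite ZSE addrC addKr.
under eq_integral do rewrite ZSE EFinD.
under [leRHS]eq_integral do rewrite ZE EFinD.
have EFin_ge0 (t : Sigma -> R) : (forall w, 0 <= t w) ->
    forall w : borel Sigma, setT w -> (0 <= (t w)%:E)%E.
  by move=> t0 w _; rewrite lee_fin.
have ag0 w : 0 <= a w * gain (v h) (w (n + h)%N) by rewrite mulr_ge0 ?gain_ge0.
rewrite (ge0_integralD _ measurableT (EFin_ge0 _ b0) mb (EFin_ge0 _ ag0) mag).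
rewrite (ge0_integralD _ measurableT (EFin_ge0 _ b0) mb (EFin_ge0 _ a0) ma).
apply: leeD => //.
rewrite (integral_fresh_symbol muS_bernoulli (K := window_list n)) //.
- rewrite -[leRHS]mul1e; apply: lee_wpmul2r.
    by apply: integral_ge0 => w _; rewrite lee_fin.
  by rewrite lee_fin gain_fair.
- move=> w w' /localP ww'; rewrite /a /Z (wealth_local _ _ _ _ ww') !indicE.
  by rewrite !inE_ (box_local _ _ _ _ ww').
- exact: gain_ge0.
Qed.

Lemma integral_wealth n : (\int[mu]_x (Z n x)%:E <= vol setT)%E.
Proof.
rewrite fubini_tonelli2; last 2 first.
- exact/measurable_EFinP.
- by move=> x; rewrite lee_fin wealth_ge0.
have sec p : (\int[muS]_w (Z n (w, p))%:E <= 1)%E.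
  elim: n => [|n IHn]; last exact: le_trans (integral_wealthS n p) IHn.
  rewrite (eq_integral (cst 1%E)) => [|w _].
    by rewrite integral_cst // mul1e; exact: probability_le1.
  by rewrite /Z /wealth /visits !big_ord0 !expr0 invr1 mulr1.
apply: (@le_trans _ _ (\int[vol]_p 1)%E); last first.
  by rewrite integral_cst // mul1e.
apply: ge0_le_integral => //.
- by move=> p _; apply: integral_ge0 => w _; rewrite lee_fin wealth_ge0.
- apply: measurable_fun_fubini_tonelli_G; first exact/measurable_EFinP.
  by move=> x; rewrite lee_fin wealth_ge0.
- by move=> p _; exact: sec.
Qed.

End fixed_box.

End future_free.

(** * The wealth controls the number of visits *)

Section growth.
Context {R : realType} {s : nat} {M : ptopologicalType}.
Local Notation X := (shift_space R s * M)%type.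
Variable f : 'I_s.+1 -> M -> M.
Local Notation F := (@skew_product R s M f).
Local Notation odds := (@odds R s).
Implicit Types (x : X) (G U : set X).

Lemma visits_le_mono x U n n' : (n <= n')%N -> (visits F x U n <= visits F x U n')%N.
Proof.
move=> /subnKC <-; elim: (n' - n)%N => [|k IHk]; first by rewrite addn0.
by rewrite addnS visitsS; apply: leq_trans IHk (leq_addr _ _).
Qed.

Lemma finitely_visitedP x U :
  finitely_visited F x U <-> exists K, forall n, (visits F x U n <= K)%N.
Proof.
split=> [[N _ NU]|[K UK]].
  exists (visits F x U N) => n; have [/ltnW/visits_le_mono //|Nn] := ltnP n N.
  rewrite -(subnKC Nn); elim: (n - N)%N => [|k IHk]; first by rewrite addn0.
  rewrite addnS visitsS memNset ?addn0 //; apply: (NU (N + k)%N); exact: leq_addr.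
apply: contrapT => notfin.
suff /(_ K.+1)[n] : forall k, exists n, (k <= visits F x U n)%N.
  by rewrite ltnNge UK.
elim=> [|k [n kn]]; first by exists 0%N.
have [n' nn' Un'] : exists2 n', (n <= n')%N & U (iter n' F x).
  apply: contrapT => noU; apply: notfin; exists n => // n' nn' Un'.
  by apply: noU; exists n'.
exists n'.+1; rewrite visitsS mem_set // addn1 ltnS.
exact: leq_trans kn (visits_le_mono _ _ nn').
Qed.

Lemma wealth_gt0 G G' n x : 0 < wealth f G G' n x :> R.
Proof. by rewrite mulr_gt0 ?invr_gt0 ?exprn_gt0 ?mulr_gt0 ?odds_gt0. Qed.

Lemma ln_odds_gt0 : 0 < ln odds.
Proof. by rewrite ln_gt0 // odds_gt1. Qed.

Lemma ln_double_odds_gt0 : 0 < ln (2 * odds).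
Proof. by rewrite ln_gt0 //; have : 1 < odds := odds_gt1; lra. Qed.

Lemma ln_wealth G G' n x : (visits F x G n)%:R * ln odds =
  ln (wealth f G G' n x) + (visits F x G' n)%:R * ln (2 * odds) :> R.
Proof.
have o0 : 0 < odds :> R by exact: odds_gt0.
have oo0 : 0 < 2 * odds :> R by rewrite mulr_gt0.
have := congr1 (@ln R) (wealthE f G G' n x).
by rewrite lnM ?posrE ?exprn_gt0 ?wealth_gt0 // !lnXn // !mulr_natl => ->.
Qed.

(** With the wealth bounded along a subsequence and finitely many lost bets,
    only finitely many bets are placed, since every successful one multiplies
    the wealth by odds > 1. *)
Lemma finitely_visited_wealth G G' x (A : R) :
  (forall N, exists2 n, (N <= n)%N & wealth f G G' n x <= A) ->
  finitely_visited F x G' -> finitely_visited F x G.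
Proof.
move=> ZA /finitely_visitedP[K GK]; apply/finitely_visitedP.
pose c := (ln A + K%:R * ln (2 * odds)) / ln odds.
exists (Num.bound c) => N; have [n Nn ZnA] := ZA N.
have Gc : (visits F x G n)%:R <= c.
  rewrite ler_pdivlMr ?ln_odds_gt0 // (ln_wealth G G'); apply: lerD.
    by rewrite ler_ln ?posrE ?wealth_gt0 // (lt_le_trans (wealth_gt0 G G' n x)).
  by rewrite ler_pM2r ?ln_double_odds_gt0 // ler_nat.
apply: leq_trans (visits_le_mono x G Nn) _; rewrite -(ler_nat R).
by apply: (le_trans Gc (ltW (archi_boundP _))); apply: le_trans Gc.
Qed.

(** A subexponential wealth and a zero frequency of lost bets force a zero
    frequency of bets: by ln_wealth, the number of bets times ln odds is a sum
    of terms that are all small with respect to n. *)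
Lemma seldom_visited_wealth G G' x :
  (forall i : nat, exists Y, forall n,
     expR (- i.+1%:R^-1) ^+ n * wealth f G G' n x <= Y :> R) ->
  seldom_visited F R x G' -> seldom_visited F R x G.
Proof.
move=> ZY G'rare e e0; set l : R := ln odds; set b : R := ln (2 * odds).
have l0 : 0 < l by exact: ln_odds_gt0.
have b0 : 0 < b by exact: ln_double_odds_gt0.
(* A third of e * l is allowed for each of ln Y, the growth rate of the wealth
   and the lost bets. *)
pose d := e * l / 3; have d0 : 0 < d by rewrite !mulr_gt0 // invr_gt0.
have [i id] : exists i : nat, i.+1%:R^-1 <= d.
  exists (Num.bound d^-1); rewrite -[leRHS]invrK lef_pV2 ?posrE ?invr_gt0 //.
  by rewrite ltW // (lt_trans (archi_boundP _)) ?invr_ge0 ?ltW // ltr_nat.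
have [Y ZnY] := ZY i.
have Y0 : 0 < Y.
  by apply: lt_le_trans (ZnY 0%N); rewrite mulr_gt0 ?exprn_gt0 ?expR_gt0 ?wealth_gt0.
have db0 : 0 < d / b by rewrite divr_gt0.
have [N _ NG'] := G'rare _ db0.
exists (maxn N (Num.bound (`|ln Y| / d))) => // n /=; rewrite geq_max => /andP[Nn Bn].
have G'n : (visits F x G' n)%:R * b <= d * n%:R.
  by rewrite -ler_pdivlMr // mulrAC; exact: NG'.
have lnY : ln Y <= d * n%:R.
  apply: le_trans (ler_norm _) _; rewrite mulrC -ler_pdivrMr //.
  apply: ltW; apply: lt_le_trans (archi_boundP _) _; last by rewrite ler_nat.
  by rewrite divr_ge0 // ltW.
have lnZ : ln (wealth f G G' n x) <= ln Y + d * n%:R.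
  have W0 := wealth_gt0 G G' n x.
  have E0 : 0 < expR (- i.+1%:R^-1) ^+ n :> R by rewrite exprn_gt0 ?expR_gt0.
  have W_Y : ln (expR (- i.+1%:R^-1) ^+ n * wealth f G G' n x) <= ln Y.
    by rewrite ler_ln ?posrE ?(mulr_gt0 E0 W0) // ZnY.
  move: W_Y; rewrite lnM ?posrE // lnXn ?expR_gt0 // expRK mulNrn.
  have : i.+1%:R^-1 *+ n <= d * n%:R by rewrite -[leLHS]mulr_natr ler_wpM2r.
  set t := _ *+ n; lra.
rewrite -(ler_pM2r l0) (ln_wealth G G') -/b.
have -> : e * n%:R * l = 3 * (d * n%:R) by rewrite /d; field.
lra.
Qed.

End growth.

(** * Stability of attractors *)

Section future_free_visits.
Context {R : realType} {s : nat} {M : ptopologicalType}.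
Local Notation Sigma := (shift_space R s).
Variables (f : 'I_s.+1 -> M -> M) (muS : probability (borel Sigma) R).
Variable vol : {finite_measure set (borel M) -> \bar R}.
Hypothesis cf : forall i, continuous (f i).
Hypothesis muS_bernoulli : is_uniform_bernoulli muS.
Local Notation F := (@skew_product R s M f).
Local Notation mu := (muS \x vol)%E.

Let integral_wealth_fine m h v B n : open B ->
  (\int[mu]_x (wealth f (box m h v B) (box m h.+1 v B) n x)%:E <=
   (fine (vol setT))%:E)%E.
Proof.
by move=> oB; rewrite fineK ?fin_num_measure //; exact: integral_wealth.
Qed.

Lemma future_free_finitely_visited : future_free mu (finitely_visited F).
Proof.
move=> m h v B oB Bh; pose Z := wealth f (box m h v B) (box m h.+1 v B).
have mZ n : measurable_fun setT (Z n : borel Sigma * borel M -> R).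
  by apply: measurable_wealth => //; exact: measurable_box.
have := ae_liminf_bounded mZ (fun n x => wealth_ge0 _ _ _ n x)
  (fun n => integral_wealth_fine m h v n oB).
apply: (@filterS2 _ _ (ae_filter_ringOfSetsType mu) _ _ _ _ Bh) => x Bx [A ZA].
exact: finitely_visited_wealth ZA Bx.
Qed.

Lemma future_free_seldom_visited : future_free mu (seldom_visited F R).
Proof.
move=> m h v B oB Bh; pose Z := wealth f (box m h v B) (box m h.+1 v B).
have mZ n : measurable_fun setT (Z n : borel Sigma * borel M -> R).
  by apply: measurable_wealth => //; exact: measurable_box.
have t01 (i : nat) : 0 < expR (- i.+1%:R^-1 : R) < 1.
  by rewrite expR_gt0 expR_lt1 oppr_lt0 invr_gt0 ltr0n.
have := ae_foralln (fun i => ae_geometric_bounded mZ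
  (fun n x => wealth_ge0 _ _ _ n x)
  (fun n => integral_wealth_fine m h v n oB) (t01 i)).
apply: (@filterS2 _ _ (ae_filter_ringOfSetsType mu) _ _ _ _ Bh) => x Bx ZY.
exact: seldom_visited_wealth ZY Bx.
Qed.

Lemma lyapunov_stable_ae_hull rare : hausdorff_space M -> compact [set: M] ->
  rarity F rare -> future_free mu rare ->
  let A := ae_hull mu (limit_set rare) in
  lyapunov_stable F A <-> lyapunov_stable F (setT `*` (snd @` A)).
Proof.
move=> hM cM rF ff A; apply: lyapunov_stable_projection => //.
- exact: closed_ae_hull.
- exact: ae_hull_absorbed rF (continuous_skew_product cf).
- exact: (ae_hull_past_saturated hM cM rF ff).
Qed.

End future_free_visits.

Theorem theorem4p9 (R : realType) (s n : nat) (M : ptopologicalType)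
    (mfd : smooth_manifold R n M) (g : riemannian_metric mfd)
    (muS : probability (borel (shift_space R s)) R)
    (vol : {finite_measure set (borel M) -> \bar R})
    (f : 'I_s.+1 -> M -> M) :
  compact [set: M] ->
  is_uniform_bernoulli muS ->
  is_riemannian_volume g vol ->
  (forall i, diffeomorphism mfd (f i)) ->
  let F : shift_space R s * M -> shift_space R s * M := skew_product f in
  let muX := (muS \x vol)%E in
  let A_stat := statistical_attractor muX F in
  let A_M := milnor_attractor muX F in
  (lyapunov_stable F A_stat <->
     lyapunov_stable F (setT `*` (snd @` A_stat))) /\
  (lyapunov_stable F A_M <-> lyapunov_stable F (setT `*` (snd @` A_M))).
Proof.
move=> cM muS_bernoulli _ f_diffeo F muX A_stat A_M.
have cf i : continuous (f i) by have [f' [_ _ [] ]] := f_diffeo i.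
have hM := manifold_hausdorff mfd.
split.
- rewrite /A_stat /statistical_attractor omega_statE.
  apply: lyapunov_stable_ae_hull => //; first exact: seldom_visited_rarity.
  exact: future_free_seldom_visited.
- rewrite /A_M /milnor_attractor omega_limitE.
  apply: lyapunov_stable_ae_hull => //; first exact: finitely_visited_rarity.
  exact: future_free_finitely_visited.
Qed.
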